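(* Let $i\in\mathcal I_D$, $l\in\mathcal I_E$, $\tau\ge0$, $\gamma=0$, let the asymptotes $L,U$ satisfy the requirements given in the context, and let $\psi_l$ be a rotational parametrization based on a real-valued diagonal reference tensor $B^{(r)}\in\mathbb S_{\mathbb R}$, i.e. $\psi_l(\delta)=R(\pi\delta)B^{(r)}R(\pi\delta)^T$ for $\delta\in[0,1]$. Set $B^L=(L^R-B^{(r)})^{-1}$, $B^U=(U^R-B^{(r)})^{-1}$ and, writing $\bar B_i$ for the (real) $i$-th component of the expansion point, $$c_0=2(B^L_{11}-B^U_{11})B^{(r)}_{11}+2(B^U_{22}-B^L_{22})B^{(r)}_{22}+\big[(B^U_{11}-B^U_{22})+(B^L_{22}-B^L_{11})\big]\big[(\bar B_i)_{11}+(\bar B_i)_{22}\big],$$ $$c_1=(B^U_{11}-B^U_{22})\big[(C^{i,R}_U)_{22}-(C^{i,R}_U)_{11}\big]+(B^L_{11}-B^L_{22})\big[(C^{i,R}_L)_{22}-(C^{i,R}_L)_{11}\big],$$ $$c_2=(B^U_{11}-B^U_{22})\big[(C^{i,R}_U)_{12}+(C^{i,R}_U)_{21}\big]+(B^L_{11}-B^L_{22})\big[(C^{i,R}_L)_{12}+(C^{i,R}_L)_{21}\big],$$ $$a=\tau\big[(\bar B_i)_{22}-(\bar B_i)_{11}\big]c_0+c_1,\qquad b=\tau\big[(\bar B_i)_{12}+(\bar B_i)_{21}\big]c_0+c_2.$$ Then the parametrized sub-problem $$\min_{\alpha_i\in[0,1]}\ f^{i,\tau}_{\bar{\boldsymbol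 B},R}(\operatorname{Re}\psi_l(\alpha_i))+f^{i,\tau}_{\bar{\boldsymbol B},I}(\operatorname{Im}\psi_l(\alpha_i))+\gamma\alpha_i(1-\alpha_i)$$ (with $\gamma=0$) has the global optimal solution $$\alpha_i^*=\frac1{2\pi}\begin{cases}\arctan(-\frac ba)+\pi& a<0,\\ \arctan(-\frac ba)\bmod 2\pi& a>0,\\ \frac\pi2\operatorname{sign}(b)+\pi& a=0.\end{cases}$$
   Context: Notation. $\mathbb S_{\mathbb C}$, $\mathbb S_{\mathbb R}$: symmetric $2\times2$ complex, real matrices; $\langle A,B\rangle=\operatorname{Re}(\operatorname{tr}(A^HB))$; $Y^R=\operatorname{Re}Y$, $Y^I=\operatorname{Im}Y$ entrywise; $\mathbb 1$ is the identity matrix; $x\bmod2\pi\in[0,2\pi)$; $\operatorname{sign}$ is the sign function with $\operatorname{sign}(0)=0$; $R(\theta)=\begin{pmatrix}\cos\theta&-\sin\theta\\ \sin\theta&\cos\theta\end{pmatrix}$. Admissible set. $(V,E)$ is a finite graph with edges $e_1,\dots,e_{N_E}$, $\mathcal I_E=\{1,\dots,N_E\}$; every vertex lies on at least one edge and carries a tensor in $\mathbb S_{\mathbb C}$. A parametrization is a map $\psi:\mathcal I_E\times[0,1]\to\mathbb S_{\mathbb C}$, $\psi_l=\psi(l,\cdot)$, twice continuously differentiable in the second variable, with $\psi_l(0),\psi_l(1)$ the tensors at the first and second node of $e_l$, and injective on $\mathcal I_E\times(0,1)$. $\mathcal G=\bigcup_l\psi_l([0,1])$, $\mathcal I_D=\{1,\dots,K\}$,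 $\mathcal B=\mathcal G^K$. Approximation terms. $f:\mathbb S_{\mathbb C}^K\to\mathbb R$ is continuously differentiable on $\mathcal B$ and $\bar{\boldsymbol B}=(\bar B_1,\dots,\bar B_K)\in\mathcal B$ is a fixed expansion point. $\nabla^{i,R}f(\bar{\boldsymbol B}),\nabla^{i,I}f(\bar{\boldsymbol B})\in\mathbb S_{\mathbb R}$ are defined by $\frac{\partial f(\bar{\boldsymbol B})}{\partial\boldsymbol B}[\boldsymbol Y]=\sum_{i=1}^K\langle\nabla^{i,R}f(\bar{\boldsymbol B}),(\boldsymbol Y)_i^R\rangle+\langle\nabla^{i,I}f(\bar{\boldsymbol B}),(\boldsymbol Y)_i^I\rangle$, and $\nabla^{i,s}_\pm f(\bar{\boldsymbol B})$ are their projections onto the symmetric positive (+) and negative (−) semidefinite matrices. Asymptotes $L=l_0\mathbb 1$, $U=u_0\mathbb 1$ ($l_0,u_0\in\mathbb C$) satisfy $L^s\prec Y^s\prec U^s$ for all $Y\in\mathcal G$, $s\in\{R,I\}$. For $s\in\{R,I\}$ put $$C^{i,s}_U=(U^s-\bar B_i^s)\nabla^{i,s}_+f(\bar{\boldsymbol B})(U^s-\bar B_i^s),\qquad C^{i,s}_L=(L^s-\bar B_i^s)\nabla^{i,s}_-f(\bar{\boldsymbol B})(L^s-\bar B_i^s),$$ $$f^{i,\tau}_{\bar{\boldsymbol B},s}(Y)=\langle C^{i,s}_U+\tau(Y-\bar B_i^s)^2,(U^s-Y)^{-1}\rangle+\langle C^{i,s}_L-\tau(Y-\bar B_i^s)^2,(L^s-Y)^{-1}\rangle.$$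 *)

(* Defs.v *)
From HB Require Import structures.
From mathcomp Require Import all_boot all_order all_algebra.
From mathcomp Require Import spectral complex.
From mathcomp Require Import all_classical all_reals all_analysis.
From mathcomp Require Import ring.

Set Implicit Arguments.
Unset Strict Implicit.
Unset Printing Implicit Defensive.

Import Order.TTheory GRing.Theory Num.Theory.
Import numFieldNormedType.Exports.

Local Open Scope classical_set_scope.
Local Open Scope ring_scope.
Local Open Scope complex_scope.
Local Open Scope sesquilinear_scope.

(* Norm induced by a positive definite bilinear form, used below to make S_C
   and S_C^K normed spaces over the reals. *)
Section FormNorm.
Context {R : rcfType} {V : lmodType R} (b : V -> V -> R).
Context (bC : forall x y, b x y = b y x).
Context (bD : forall x y z, b (x + y) z = b x z + b y z).
Context (bZ : forall k x y, b (k *: x) y = k * b x y).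
Context (b_ge0 : forall x, 0 <= b x x).
Context (b_eq0 : forall x, b x x = 0 -> x = 0).

Let bDr x y z : b z (x + y) = b z x + b z y.
Proof. by rewrite bC bD !(bC z). Qed.

Let bZr k x y : b x (k *: y) = k * b x y.
Proof. by rewrite bC bZ bC. Qed.

Lemma form_CS x y : b x y ^+ 2 <= b x x * b y y.
Proof.
have [y0|y0] := eqVneq (b y y) 0.
  rewrite (b_eq0 y0) -(scale0r 0) !bZr !mul0r expr0n mulr0 //.
have yp : 0 < b y y by rewrite lt_def y0 b_ge0.
have := b_ge0 (b y y *: x + (- b x y) *: y).
rewrite bD !bDr !bZ !bZr (bC y x) => h.
rewrite -subr_ge0 -(pmulr_rge0 _ yp); apply: le_trans h _.
by rewrite le_eqVlt; apply/orP; left; apply/eqP; ring.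
Qed.

Lemma form_normD x y :
  Num.sqrt (b (x + y) (x + y)) <= Num.sqrt (b x x) + Num.sqrt (b y y).
Proof.
have s0 : 0 <= Num.sqrt (b x x) + Num.sqrt (b y y) by rewrite addr_ge0 ?sqrtr_ge0.
rewrite -(ler_pXn2r (ltn0Sn 1)) ?nnegrE ?sqrtr_ge0 // sqrrD !sqr_sqrtr ?b_ge0 //.
rewrite bD !bDr (bC y x) addrA -(addrA (b x x)) -mulr2n lerD2r lerD2l lerMn2r /=.
rewrite (le_trans (ler_norm _)) // -sqrtrM ?b_ge0 // -sqrtr_sqr.
by rewrite ler_wsqrtr // form_CS.
Qed.

Lemma form_normZ k x : Num.sqrt (b (k *: x) (k *: x)) = `|k| * Num.sqrt (b x x).
Proof. by rewrite bZ bZr mulrA -expr2 sqrtrM ?sqr_ge0 // sqrtr_sqr. Qed.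

Lemma form_norm_eq0 x : Num.sqrt (b x x) = 0 -> x = 0.
Proof.
move/eqP; rewrite sqrtr_eq0 => h; apply: b_eq0.
by apply/eqP; rewrite eq_le h b_ge0.
Qed.

End FormNorm.

Definition inner {R : realType} (A B : 'M[R[i]]_2) : R :=
  complex.Re (\tr (A ^t* *m B)).

Definition innerR {R : realType} (A B : 'M[R]_2) : R :=
  inner (map_mx (real_complex R) A) (map_mx (real_complex R) B).

Lemma innerE {R : realType} (A B : 'M[R[i]]_2) :
  inner A B = \sum_j \sum_k (complex.Re (A k j) * complex.Re (B k j)
                           + complex.Im (A k j) * complex.Im (B k j)).
Proof.
rewrite /inner /mxtrace raddf_sum; apply: eq_bigr => j _.
rewrite mxE raddf_sum; apply: eq_bigr => k _.
rewrite !mxE; case: (A k j) (B k j) => [u v] [w t] /=.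
by rewrite mulNr opprK.
Qed.

Lemma innerC {R : realType} (A B : 'M[R[i]]_2) : inner A B = inner B A.
Proof.
rewrite !innerE; apply: eq_bigr => j _; apply: eq_bigr => k _.
by rewrite (mulrC (complex.Re _)) (mulrC (complex.Im _)).
Qed.

Lemma innerD {R : realType} (A B D : 'M[R[i]]_2) :
  inner (A + B) D = inner A D + inner B D.
Proof.
rewrite !innerE -big_split; apply: eq_bigr => j _ /=.
rewrite -big_split; apply: eq_bigr => k _ /=.
by rewrite !mxE; case: (A k j) (B k j) => [u v] [w t] /=; ring.
Qed.

Lemma innerZ {R : realType} (c : R) (A B : 'M[R[i]]_2) :
  inner (c%:C *: A) B = c * inner A B.
Proof.
rewrite !innerE mulr_sumr; apply: eq_bigr => j _.
rewrite mulr_sumr; apply: eq_bigr => k _.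
by rewrite !mxE; case: (A k j) => [u v] /=; ring.
Qed.

Lemma inner_ge0 {R : realType} (A : 'M[R[i]]_2) : 0 <= inner A A.
Proof.
rewrite innerE; apply: sumr_ge0 => j _; apply: sumr_ge0 => k _.
by rewrite -!expr2 addr_ge0 ?sqr_ge0.
Qed.

Lemma inner_eq0 {R : realType} (A : 'M[R[i]]_2) : inner A A = 0 -> A = 0.
Proof.
have h0 j k : 0 <= complex.Re (A k j) * complex.Re (A k j)
                 + complex.Im (A k j) * complex.Im (A k j).
  by rewrite -!expr2 addr_ge0 ?sqr_ge0.
rewrite innerE => /eqP; rewrite psumr_eq0; last first.
  by move=> j _; apply: sumr_ge0.
move=> /allP hA; apply/matrixP => k j.
have := hA j (mem_index_enum _); rewrite psumr_eq0 => [/allP hj|k' _]; last exact: h0.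
have := hj k (mem_index_enum _); rewrite /= -!expr2 paddr_eq0 ?sqr_ge0 //.
by rewrite !sqrf_eq0 mxE; case: (A k j) => [u v] /= /andP[/eqP-> /eqP->].
Qed.

Definition symmx {R : realType} : {pred 'M[R[i]]_2} := fun A => A^T == A.

Fact symmx_zmod_closed {R : realType} : zmod_closed (@symmx R).
Proof.
split => [|A B]; rewrite !unfold_in ?trmx0 // => /eqP hA /eqP hB.
by rewrite linearB /= hA hB.
Qed.

HB.instance Definition _ (R : realType) :=
  GRing.isZmodClosed.Build 'M[R[i]]_2 (@symmx R) symmx_zmod_closed.

(* The space S_C, as a normed space over the reals, not over R[i]. *)
Record symC (R : realType) := SymC {
  symC_mx :> 'M[R[i]]_2;
  symC_mxP : symC_mx \in symmx
}.

HB.instance Definition _ (R : realType) := [isSub for @symC_mx R].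
HB.instance Definition _ (R : realType) := [Choice of symC R by <:].
HB.instance Definition _ (R : realType) :=
  [SubChoice_isSubZmodule of symC R by <:].

Section SymC.
Context {R : realType}.
Implicit Types (A B : symC R) (c d : R).

Fact symC_scale_subproof c A : c%:C *: symC_mx A \in symmx.
Proof. by rewrite unfold_in linearZ /= (eqP (symC_mxP A)). Qed.

Definition symC_scale c A : symC R := SymC (symC_scale_subproof c A).

Fact symC_scalerA c d A :
  symC_scale c (symC_scale d A) = symC_scale (c * d) A.
Proof. by apply/val_inj; rewrite /= scalerA rmorphM. Qed.

Fact symC_scale1r : left_id 1 symC_scale.
Proof. by move=> A; apply/val_inj; rewrite /= rmorph1 scale1r. Qed.

Fact symC_scalerDr : right_distributive symC_scale +%R.
Proof. by move=> c A B; apply/val_inj; rewrite /= scalerDr. Qed.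

Fact symC_scalerDl A : {morph symC_scale^~ A : c d / c + d}.
Proof. by move=> c d; apply/val_inj; rewrite /= rmorphD scalerDl. Qed.

HB.instance Definition _ := GRing.Zmodule_isLmodule.Build R (symC R)
  symC_scalerA symC_scale1r symC_scalerDr symC_scalerDl.

Definition symC_form A B : R := inner A B.

Lemma symC_formC A B : symC_form A B = symC_form B A.
Proof. exact: innerC. Qed.
Lemma symC_formD A B D : symC_form (A + B) D = symC_form A D + symC_form B D.
Proof. exact: innerD. Qed.
Lemma symC_formZ c A B : symC_form (c *: A) B = c * symC_form A B.
Proof. exact: innerZ. Qed.
Lemma symC_form_ge0 A : 0 <= symC_form A A.
Proof. exact: inner_ge0. Qed.
Lemma symC_form_eq0 A : symC_form A A = 0 -> A = 0.
Proof. by move/inner_eq0 => h; apply/val_inj. Qed.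

HB.instance Definition _ := Lmodule_isNormed.Build R (symC R)
  (form_normD symC_formC symC_formD symC_formZ symC_form_ge0 symC_form_eq0)
  (form_normZ symC_formC symC_formZ)
  (form_norm_eq0 symC_form_ge0 symC_form_eq0).

End SymC.

Definition tensors (R : realType) (K : nat) := {ffun 'I_K -> symC R}.
Definition tensors_fun (R : realType) (K : nat) (x : tensors R K) :
  'I_K -> symC R := x : {ffun 'I_K -> symC R}.
Coercion tensors_fun : tensors >-> Funclass.

HB.instance Definition _ (R : realType) (K : nat) :=
  GRing.Lmodule.copy (tensors R K) {ffun 'I_K -> symC R}.

Section Tensors.
Context {R : realType} {K : nat}.
Implicit Types (x y z : tensors R K) (c : R).

Definition tensors_form x y : R := \sum_(i < K) inner (x i) (y i).

Lemma tensors_formC x y : tensors_form x y = tensors_form y x.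
Proof. by apply: eq_bigr => i _; exact: innerC. Qed.
Lemma tensors_formD x y z :
  tensors_form (x + y) z = tensors_form x z + tensors_form y z.
Proof.
rewrite -big_split; apply: eq_bigr => i _.
by rewrite /tensors_fun ffunE innerD.
Qed.
Lemma tensors_formZ c x y : tensors_form (c *: x) y = c * tensors_form x y.
Proof.
rewrite mulr_sumr; apply: eq_bigr => i _.
by rewrite /tensors_fun ffunE innerZ.
Qed.
Lemma tensors_form_ge0 x : 0 <= tensors_form x x.
Proof. by apply: sumr_ge0 => i _; exact: inner_ge0. Qed.
Lemma tensors_form_eq0 x : tensors_form x x = 0 -> x = 0.
Proof.
move/eqP; rewrite psumr_eq0 => [/allP h|i _]; last exact: inner_ge0.
apply/ffunP => i; rewrite ffunE; apply/val_inj/inner_eq0/eqP.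
exact: h (mem_index_enum _).
Qed.

HB.instance Definition _ := Lmodule_isNormed.Build R (tensors R K)
  (form_normD tensors_formC tensors_formD tensors_formZ tensors_form_ge0
     tensors_form_eq0)
  (form_normZ tensors_formC tensors_formZ)
  (form_norm_eq0 tensors_form_ge0 tensors_form_eq0).

End Tensors.

Section Model.
Context {R : realType}.

(* The superscript s in {R, I}. *)
Inductive part := RePart | ImPart.

Definition cpart (s : part) (z : R[i]) : R :=
  match s with RePart => complex.Re z | ImPart => complex.Im z end.

Definition mxpart (s : part) (Y : 'M[R[i]]_2) : 'M[R]_2 := map_mx (cpart s) Y.

Definition symR : set 'M[R]_2 := [set A | A^T = A].

Definition psd : set 'M[R]_2 :=
  [set A | symR A /\ forall x : 'cV[R]_2, 0 <= (x^T *m A *m x) 0 0].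

Definition nsd : set 'M[R]_2 :=
  [set A | symR A /\ forall x : 'cV[R]_2, (x^T *m A *m x) 0 0 <= 0].

Definition posdef : set 'M[R]_2 :=
  [set A | symR A /\ forall x : 'cV[R]_2, x != 0 -> 0 < (x^T *m A *m x) 0 0].

Definition loewner_lt (A B : 'M[R]_2) := posdef (B - A).

Definition is_projection (S : set 'M[R]_2) (A P : 'M[R]_2) :=
  S P /\ forall Q, S Q -> innerR (A - P) (A - P) <= innerR (A - Q) (A - Q).

Definition has_derivative_within {V : normedModType R}
    (A : set R) (g : R -> V) (x : R) (d : V) :=
  (y - x)^-1 *: (g y - g x) @[y --> within A (x^')] --> d.

Definition C2_on {V : normedModType R} (A : set R) (g : R -> V) :=
  exists g1 g2 : R -> V,
    [/\ forall x, A x -> has_derivative_within A g x (g1 x),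
        forall x, A x -> has_derivative_within A g1 x (g2 x) &
        {within A, continuous g2}].

Definition C1_on {V : normedModType R} (A : set V) (f : V -> R) :=
  (forall x, A x -> differentiable f x) /\
  forall v : V, {within A, continuous (fun x => 'd f x v)}.

(* A graph with vertices V is given by the list of its edges as pairs
   (first node, second node); psi l is only relevant on [0, 1]. *)
Definition is_parametrization {V : finType} {N : nat} (edge : 'I_N -> V * V)
    (tensor : V -> symC R) (psi : 'I_N -> R -> symC R) :=
  [/\ forall l, C2_on `[0, 1] (psi l),
      forall l, psi l 0 = tensor (edge l).1 /\ psi l 1 = tensor (edge l).2 &
      forall l m x y, 0 < x < 1 -> 0 < y < 1 -> psi l x = psi m y ->
        l = m /\ x = y].

Definition graph_set {N : nat} (psi : 'I_N -> R -> symC R) : set (symC R) :=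
  \bigcup_(l in [set: 'I_N]) (psi l @` `[0, 1]).

Definition admissible_set {N K : nat} (psi : 'I_N -> R -> symC R) :
    set (tensors R K) :=
  [set x | forall i, graph_set psi (x i)].

Definition are_asymptotes (S : set (symC R)) (L U : 'M[R[i]]_2) :=
  (exists l0, L = l0%:M) /\ (exists u0, U = u0%:M) /\
  forall Y, S Y -> forall s,
    loewner_lt (mxpart s L) (mxpart s Y) /\
    loewner_lt (mxpart s Y) (mxpart s U).

Definition is_gradient {K : nat} (f : tensors R K -> R) (x : tensors R K)
    (g : part -> 'I_K -> 'M[R]_2) :=
  (forall s i, symR (g s i)) /\
  forall Y : tensors R K, 'd f x Y =
    \sum_(i < K) (innerR (g RePart i) (mxpart RePart (Y i))
                + innerR (g ImPart i) (mxpart ImPart (Y i))).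

(* C_U^{i,s} and C_L^{i,s}, for T = U, g = nabla_+ and T = L, g = nabla_-. *)
Definition Ccoef {K : nat} (T : 'M[R[i]]_2) (Bbar : tensors R K)
    (g : part -> 'I_K -> 'M[R]_2) (i : 'I_K) (s : part) : 'M[R]_2 :=
  (mxpart s T - mxpart s (Bbar i)) *m g s i *m (mxpart s T - mxpart s (Bbar i)).

Definition approx_term {K : nat} (L U : 'M[R[i]]_2) (Bbar : tensors R K)
    (gp gm : part -> 'I_K -> 'M[R]_2) (i : 'I_K) (tau : R) (s : part)
    (Y : 'M[R]_2) : R :=
  innerR (Ccoef U Bbar gp i s + tau *: (Y - mxpart s (Bbar i)) ^+ 2)
         (invmx (mxpart s U - Y))
  + innerR (Ccoef L Bbar gm i s - tau *: (Y - mxpart s (Bbar i)) ^+ 2)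
           (invmx (mxpart s L - Y)).

Definition subproblem {K N : nat} (psi : 'I_N -> R -> symC R)
    (L U : 'M[R[i]]_2) (Bbar : tensors R K)
    (gp gm : part -> 'I_K -> 'M[R]_2) (i : 'I_K) (l : 'I_N)
    (tau gamma alpha : R) : R :=
  approx_term L U Bbar gp gm i tau RePart (mxpart RePart (psi l alpha))
  + approx_term L U Bbar gp gm i tau ImPart (mxpart ImPart (psi l alpha))
  + gamma * alpha * (1 - alpha).

Definition rot (t : R) : 'M[R]_2 :=
  \matrix_(j, k) if j == k then cos t else if j == 0 then - sin t else sin t.

Definition is_rotational (psi : R -> symC R) (Br : 'M[R]_2) :=
  forall d, 0 <= d <= 1 ->
    psi d = map_mx (real_complex R) (rot (pi * d) *m Br *m (rot (pi * d))^T)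
      :> 'M[R[i]]_2.

Definition mod2pi (x : R) : R := x - 2 * pi * (Num.floor (x / (2 * pi)))%:~R.

Definition global_minimizer (A : set R) (h : R -> R) (x : R) :=
  A x /\ forall y, A y -> h x <= h y.

End Model.

(* Main.v *)
Require Import Defs.
From HB Require Import structures.
From mathcomp Require Import all_boot all_order all_algebra.
From mathcomp Require Import complex.
From mathcomp Require Import all_classical all_reals all_analysis.
From mathcomp Require Import ring lra.
Import Order.TTheory GRing.Theory Num.Theory.
Import numFieldNormedType.Exports.
Local Open Scope classical_set_scope.
Local Open Scope ring_scope.

(** Write the reference tensor as [Br = diag(p, q)] and [E = (w 1 - Br)^-1] for
    an asymptote [w 1].  Rotations commute with scalar matrices, so along the
    path [Y = R Br R^T] one has [(w 1 - Y)^-1 = R E R^T]: the inverse is rotated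
    together with [Y].

    Two facts make the objective elementary.  Pairing a matrix [A] with
    [R D R^T], [D] diagonal, gives a constant plus a combination of the cosine
    and the sine of twice the rotation angle, with amplitudes proportional to
    [A 0 0 - A 1 1] and [A 0 1 + A 1 0] ([innerR_diag_rotconj]).  Expanding
    [<(Y - B)^2, W>] with [W = (w 1 - Y)^-1], which commutes with [Y], leaves
    only such pairings: with [R E R^T], with [R Br E R^T], and a trace
    that does not see the rotation ([innerR_sq_sub]).  The deviatoric and
    off-diagonal parts of [B *m B] are those of [B] times [\tr B], so the tau
    term has the same shape ([term_rotconj]).

    Adding the two asymptotes, the second with [- tau], and noting that the
    imaginary part of [Y] is the zero matrix, the objective at [y] becomes
    [k + (b sin x - a cos x) / 2] with [x = 2 pi y].  Such a sinusoid is
    minimal where the vector [(cos x, sin x)] points along [(a, - b)]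
    ([sinusoid_min]), and the three cases of the formula compute the angle of
    this vector in [[0, 2 pi]] ([optimal_angle_polar], [optimal_angle_itv]). *)

(** * Minimizing a sinusoid *)

Lemma cosD2pi_int {R : realType} (x : R) (n : int) :
  cos (x + 2 * pi * n%:~R) = cos x /\ sin (x + 2 * pi * n%:~R) = sin x.
Proof.
have pos (y : R) m : cos (y + 2 * pi * m%:R) = cos y /\
                     sin (y + 2 * pi * m%:R) = sin y.
  have -> : 2 * pi * m%:R = pi *+ 2 *+ m :> R by rewrite mulr_natl mulr_natr.
  by rewrite (periodicn (cosD2pi (R := R))) (periodicn (sinD2pi (R := R))).
case: n => m; first exact: pos.
rewrite NegzE mulrNz mulrN.
have [] := pos (x - 2 * pi * m.+1%:R) m.+1.
by rewrite subrK => -> ->.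
Qed.

Lemma cos_sin_mod2pi {R : realType} (x : R) :
  cos (mod2pi x) = cos x /\ sin (mod2pi x) = sin x.
Proof.
have := cosD2pi_int x (- Num.floor (x / (2 * pi))).
by rewrite mulrNz mulrN.
Qed.

Lemma mod2pi_itv {R : realType} (x : R) : 0 <= mod2pi x < 2 * pi.
Proof.
have p0 : 0 < 2 * pi :> R by rewrite mulr_gt0 ?pi_gt0.
have /andP[] := floor_itv (x / (2 * pi)).
rewrite ler_pdivlMr // ltr_pdivrMr // intrD /mod2pi.
set k := _%:~R => h1 h2; apply/andP; split; lra.
Qed.

(** With [(a, - b)] in polar form, [b sin y - a cos y = - r cos (x - y)], which
    is at least its value [- r] at [y = x]. *)
Lemma sinusoid_min {R : realType} (a b r x : R) :
  0 <= r -> r * cos x = a -> r * sin x = - b ->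
  forall y, b * sin x - a * cos x <= b * sin y - a * cos y.
Proof.
move=> r0 <- /eqP; rewrite eq_sym eqr_oppLR => /eqP -> y.
have := mulr_ge0 r0 (_ : 0 <= 1 - cos (x - y)).
rewrite subr_ge0 cos_le1 cosB => /(_ isT).
have := cos2Dsin2 x.
move: (cos x) (sin x) (cos y) (sin y) => cx sx cy sy h.
have -> : - (r * sx) * sx - r * cx * cx = - (r * (cx ^+ 2 + sx ^+ 2)) by ring.
by rewrite h; lra.
Qed.

Definition optimal_angle {R : realType} (a b : R) : R :=
  if a < 0 then atan (- (b / a)) + pi
  else if 0 < a then mod2pi (atan (- (b / a)))
  else pi / 2 * Num.sg b + pi.

Lemma optimal_angle_itv {R : realType} (a b : R) :
  0 <= optimal_angle a b <= 2 * pi.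
Proof.
have p0 := pi_gt0 R.
rewrite /optimal_angle; case: ifP => _; last case: ifP => _.
- have := atan_gtNpi2 (- (b / a)); have := atan_ltpi2 (- (b / a)).
  by move=> h1 h2; apply/andP; split; lra.
- by have /andP[-> /ltW] := mod2pi_itv (atan (- (b / a))).
- case: (sgrP b) => _; rewrite ?mulr0 ?mulr1 ?mulrN1;
  by apply/andP; split; lra.
Qed.

(** The tangent determines the direction of [(a, - b)] up to a half turn; since
    [atan] takes values where the cosine is positive, a half turn is added
    exactly when [a < 0].  On the vertical axis the sign of [b] decides. *)
Lemma optimal_angle_polar {R : realType} (a b : R) :
  exists r, [/\ 0 <= r, r * cos (optimal_angle a b) = a
                & r * sin (optimal_angle a b) = - b].
Proof.
rewrite /optimal_angle; set t := atan _.
have ct : 0 < cos t by rewrite cos_gt0_pihalf // atan_gtNpi2 atan_ltpi2.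
have st : a != 0 -> a * sin t = - b * cos t.
  move=> a0; have := atanK (- (b / a)); rewrite -/t /tan => h.
  have -> : sin t = - (b / a) * cos t by rewrite -h divfK // gt_eqF.
  by field.
have c0 : cos t != 0 by rewrite gt_eqF.
case: (ltgtP a 0) => [a0|a0|->].
- exists (- a / cos t); rewrite cosDpi sinDpi; split.
  + by rewrite divr_ge0 ?ltW // oppr_gt0.
  + by field.
  + have -> : - a / cos t * - sin t = a * sin t / cos t by field.
    by rewrite st ?lt_eqF //; field.
- have [-> ->] := cos_sin_mod2pi t.
  exists (a / cos t); split.
  + by rewrite divr_ge0 ?ltW.
  + by field.
  + have -> : a / cos t * sin t = a * sin t / cos t by field.
    by rewrite st ?gt_eqF //; field.
- exists `|b|; rewrite cosDpi sinDpi; split => //.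
  + case: (sgrP b) => _; rewrite ?mul0r // ?mulr1 ?mulrN1 ?cosN cos_pihalf.
      by rewrite oppr0 mulr0.
    by rewrite oppr0 mulr0.
  + case: (sgrP b) => [->|_|_].
    * by rewrite mul0r oppr0.
    * by rewrite mulr1 sin_pihalf mulrN1.
    * by rewrite mulrN1 sinN sin_pihalf opprK mulr1.
Qed.

(** * Diagonal 2 x 2 matrices *)

Lemma sum_ord2 {V : nmodType} (F : 'I_2 -> V) : \sum_i F i = F 0 + F 1.
Proof.
by rewrite !big_ord_recl big_ord0 addr0; congr (F _ + F _); apply/val_inj.
Qed.

Lemma is_diag_invmx {F : fieldType} n (X : 'M[F]_n) :
  is_diag_mx X -> X \in unitmx -> is_diag_mx (invmx X).
Proof.
move=> /diag_mxP[d ->] uX; apply/is_diag_mxP => j k jk.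
have := mulmxV uX; rewrite mul_diag_mx => /matrixP h.
have := h j j; rewrite !mxE eqxx => /eqP h1.
have := h j k; rewrite !mxE -val_eqE (negPf jk) => /eqP.
rewrite mulf_eq0 => /orP[|/eqP //] /eqP d0.
by move: h1; rewrite d0 mul0r eq_sym oner_eq0.
Qed.

Lemma diag2_off {V : nmodType} (D : 'M[V]_2) :
  is_diag_mx D -> D 0 1 = 0 /\ D 1 0 = 0.
Proof. by move/is_diag_mxP => h; split; apply: h. Qed.

(** * Conjugation by a rotation *)

Definition rotconj {R : realType} (t : R) (X : 'M[R]_2) : 'M[R]_2 :=
  Defs.rot t *m X *m (Defs.rot t)^T.

Lemma rot_unitary {R : realType} (t : R) : (Defs.rot t)^T *m Defs.rot t = 1%:M.
Proof.
apply/matrixP => j k; rewrite !mxE !big_ord_recl big_ord0 !mxE /=.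
have h := cos2Dsin2 t.
case: j => -[|[|//]] ?; case: k => -[|[|//]] ? /=.
all: rewrite -?h; ring.
Qed.

Lemma rot0 {R : realType} : Defs.rot 0 = 1%:M :> 'M[R]_2.
Proof.
apply/matrixP => j k; rewrite !mxE cos0 sin0.
by case: eqP => // _; case: ifP => _; rewrite ?oppr0.
Qed.

Section Rotconj.
Context {R : realType}.
Implicit Types (t w : R) (A B C D E X Y : 'M[R]_2).

Lemma rotconj0 X : rotconj 0 X = X.
Proof. by rewrite /rotconj rot0 trmx1 mulmx1 mul1mx. Qed.

Lemma rotconjB t X Y : rotconj t (X - Y) = rotconj t X - rotconj t Y.
Proof. by rewrite /rotconj mulmxBr mulmxBl. Qed.

Lemma rotconjM t X Y : rotconj t X *m rotconj t Y = rotconj t (X *m Y).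
Proof.
rewrite /rotconj !mulmxA -[_ *m (Defs.rot t)^T *m Defs.rot t]mulmxA.
by rewrite rot_unitary mulmx1.
Qed.

Lemma rotconj_scalar t w : rotconj t w%:M = w%:M.
Proof.
by rewrite /rotconj scalar_mxC -mulmxA (mulmx1C (rot_unitary t)) mulmx1.
Qed.

Lemma rotconj_tr t X : (rotconj t X)^T = rotconj t X^T.
Proof. by rewrite /rotconj !trmx_mul trmxK mulmxA. Qed.

Lemma mxtrace_rotconj t X : \tr (rotconj t X) = \tr X.
Proof. by rewrite /rotconj mxtrace_mulC mulmxA rot_unitary mul1mx. Qed.

Lemma invmx_rotconj t X : X \in unitmx ->
  invmx (rotconj t X) = rotconj t (invmx X).
Proof.
move=> uX.
have h : rotconj t X *m rotconj t (invmx X) = 1%:M.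
  by rewrite rotconjM mulmxV // rotconj_scalar.
have [uY _] := mulmx1_unit h.
by rewrite -[RHS]mul1mx -(mulVmx uY) -mulmxA h mulmx1.
Qed.

(** * The trace inner product *)

Lemma innerR_tr A B : innerR A B = \tr (A^T *m B).
Proof.
rewrite /innerR innerE /mxtrace; apply: eq_bigr => j _.
by rewrite mxE; apply: eq_bigr => k _; rewrite !mxE /= mul0r addr0.
Qed.

(** Double-angle formulas: the columns of [rot t] are [(cos t, sin t)] and
    [(- sin t, cos t)], and on such vectors the quadratic form of [A] is
    half its trace plus or minus half the displayed sinusoid. *)
Lemma innerR_diag_rotconj t A D : is_diag_mx D ->
  innerR A (rotconj t D) =
    2^-1 * (\tr A * \tr D
            + (D 0 0 - D 1 1) * (cos (t *+ 2) * (A 0 0 - A 1 1)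
                                 + sin (t *+ 2) * (A 0 1 + A 1 0))).
Proof.
move=> /diag2_off[D01 D10]; rewrite innerR_tr /rotconj cos_mulr2n sin_mulr2n.
rewrite /mxtrace !(mxE, sum_ord2) /= D01 D10.
have h : sin t ^+ 2 = 1 - cos t ^+ 2 by rewrite -(cos2Dsin2 t); ring.
rewrite !mulr0 !addr0 !add0r.
have e x : sin t * x * sin t = (1 - cos t ^+ 2) * x by rewrite -h; ring.
rewrite !mulrN !mulNr !opprK !e.
by field.
Qed.

(** The cross terms [A *m B] and [B *m A] contribute equally: [W] commutes with
    the symmetric matrix [A], and the trace is cyclic. *)
Lemma innerR_sq_sub A B W : A^T = A -> A *m W = W *m A ->
  innerR ((A - B) ^+ 2) W
    = innerR (B *m B) W - 2 * innerR B (A *m W) + \tr (A *m A *m W).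
Proof.
move=> AT AW; have -> : (A - B) ^+ 2 = (A - B) *m (A - B) by [].
have trB (X Y : 'M[R]_2) : (X - Y)^T = X^T - Y^T by rewrite raddfB.
have trcB (X Y : 'M[R]_2) : \tr (X - Y) = \tr X - \tr Y by rewrite raddfB.
rewrite !innerR_tr mulmxBl !mulmxBr !trB !mulmxBl !trcB !trmx_mul AT.
rewrite -!mulmxA [\tr (A *m (B^T *m W))]mxtrace_mulC -mulmxA -AW.
by ring.
Qed.

Lemma innerR_addZ C B W s :
  innerR (C + s *: B) W = innerR C W + s * innerR B W.
Proof.
by rewrite !innerR_tr raddfD mulmxDl raddfD /= linearZ -scalemxAl mxtraceZ.
Qed.

(** * The contribution of one asymptote *)

(** Serves both asymptotes: [s] is tau for the upper and [- tau] for the lower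
    one.  The summand [k] absorbs everything that is invariant under
    rotation. *)
Lemma term_rotconj w s C B D :
    is_diag_mx D -> w%:M - D \in unitmx -> let E := invmx (w%:M - D) in
  exists k, forall t,
    innerR (C + s *: (rotconj t D - B) ^+ 2) (invmx (w%:M - rotconj t D))
    = k + 2^-1 *
      (cos (t *+ 2) * ((E 0 0 - E 1 1) * (C 0 0 - C 1 1)
         + s * (B 0 0 - B 1 1) * ((E 0 0 - E 1 1) * (B 0 0 + B 1 1)
                                  - 2 * (D 0 0 * E 0 0 - D 1 1 * E 1 1)))
       + sin (t *+ 2) * ((E 0 0 - E 1 1) * (C 0 1 + C 1 0)
         + s * (B 0 1 + B 1 0) * ((E 0 0 - E 1 1) * (B 0 0 + B 1 1)
                                  - 2 * (D 0 0 * E 0 0 - D 1 1 * E 1 1)))).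
Proof.
move=> dD uX E.
have dX : is_diag_mx (w%:M - D).
  case/diag_mxP: dD => d ->; apply/is_diag_mxP => j k jk.
  by rewrite !mxE -val_eqE (negPf jk) subr0.
have dE : is_diag_mx E by exact: is_diag_invmx.
have [D01 D10] := diag2_off _ dD.
have DT : D^T = D by case/diag_mxP: dD => d ->; rewrite tr_diag_mx.
have DE : D *m E = E *m D.
  by case/diag_mxP: dD => d ->; case/diag_mxP: dE => e ->;
    rewrite !mulmx_diag; congr diag_mx; apply/rowP => j; rewrite !mxE mulrC.
have dDE : is_diag_mx (D *m E).
  by case/diag_mxP: dD => d ->; case/diag_mxP: dE => e ->;
    rewrite mulmx_diag diag_mx_is_diag.
exists (2^-1 * \tr C * \tr E + s * (2^-1 * \tr (B *m B) * \tr E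
        - \tr B * \tr (D *m E) + \tr (D *m D *m E))) => t.
rewrite -(rotconj_scalar t w) -rotconjB invmx_rotconj // -/E.
rewrite innerR_addZ innerR_sq_sub; first last.
- by rewrite !rotconjM DE.
- by rewrite rotconj_tr DT.
rewrite !rotconjM mxtrace_rotconj !innerR_diag_rotconj //.
(* Cayley-Hamilton: B *m B is (\tr B) *: B up to a multiple of the identity. *)
have BB : (B *m B) 0 0 - (B *m B) 1 1 = (B 0 0 - B 1 1) * (B 0 0 + B 1 1).
  by rewrite !(mxE, sum_ord2); ring.
have BB' : (B *m B) 0 1 + (B *m B) 1 0 = (B 0 1 + B 1 0) * (B 0 0 + B 1 1).
  by rewrite !(mxE, sum_ord2); ring.
have DE0 : (D *m E) 0 0 = D 0 0 * E 0 0.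
  by rewrite mxE sum_ord2 D01 mul0r addr0.
have DE1 : (D *m E) 1 1 = D 1 1 * E 1 1.
  by rewrite mxE sum_ord2 D10 mul0r add0r.
rewrite BB BB' DE0 DE1.
by field.
Qed.

End Rotconj.

(** * The sub-problem *)

Lemma posdef_unitmx {R : realType} (A : 'M[R]_2) : posdef A -> A \in unitmx.
Proof.
move=> [_ pA]; rewrite unitmxE unitfE; apply/negP => /det0P[v v0 vA].
have := pA v^T; rewrite trmxK vA mul0mx mxE ltxx trmx_eq0 => /(_ v0).
by [].
Qed.

Lemma mxpart_scalar {R : realType} s (z : R[i]) :
  mxpart s z%:M = (cpart s z)%:M.
Proof.
apply/matrixP => j k; rewrite !mxE; case: s; case: eqP => //=;
by rewrite ?mulr1n ?mulr0n.
Qed.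

Lemma mxpart_real {R : realType} (A : 'M[R]_2) :
  mxpart RePart (map_mx (real_complex R) A) = A /\
  mxpart ImPart (map_mx (real_complex R) A) = 0.
Proof. by split; apply/matrixP => j k; rewrite !mxE. Qed.

Theorem theorem4p17 (R : realType)
  (V : finType) (N K : nat) (edge : 'I_N -> V * V) (tensor : V -> symC R)
  (hV : forall v : V, exists l : 'I_N, v = (edge l).1 \/ v = (edge l).2)
  (psi : 'I_N -> R -> symC R) (hpsi : is_parametrization edge tensor psi)
  (f : tensors R K -> R) (hf : C1_on (admissible_set psi) f)
  (Bbar : tensors R K) (hBbar : admissible_set psi Bbar)
  (grad gradp gradm : part -> 'I_K -> 'M[R]_2)
  (hgrad : is_gradient f Bbar grad)
  (hgradp : forall s i, is_projection psd (grad s i) (gradp s i))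
  (hgradm : forall s i, is_projection nsd (grad s i) (gradm s i))
  (L U : 'M[R[i]]_2) (hLU : are_asymptotes (graph_set psi) L U)
  (i : 'I_K) (l : 'I_N) (tau gamma : R) (htau : 0 <= tau) (hgamma : gamma = 0)
  (Br : 'M[R]_2) (hBr : is_diag_mx Br) (hrot : is_rotational (psi l) Br) :
  let Bi := mxpart RePart (Bbar i) in
  let BL := invmx (mxpart RePart L - Br) in
  let BU := invmx (mxpart RePart U - Br) in
  let CU := Ccoef U Bbar gradp i RePart in
  let CL := Ccoef L Bbar gradm i RePart in
  let c0 := 2 * (BL 0 0 - BU 0 0) * Br 0 0 + 2 * (BU 1 1 - BL 1 1) * Br 1 1
            + ((BU 0 0 - BU 1 1) + (BL 1 1 - BL 0 0)) * (Bi 0 0 + Bi 1 1) in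
  let c1 := (BU 0 0 - BU 1 1) * (CU 1 1 - CU 0 0)
            + (BL 0 0 - BL 1 1) * (CL 1 1 - CL 0 0) in
  let c2 := (BU 0 0 - BU 1 1) * (CU 0 1 + CU 1 0)
            + (BL 0 0 - BL 1 1) * (CL 0 1 + CL 1 0) in
  let a := tau * (Bi 1 1 - Bi 0 0) * c0 + c1 in
  let b := tau * (Bi 0 1 + Bi 1 0) * c0 + c2 in
  let alpha := (2 * pi)^-1 *
    (if a < 0 then atan (- (b / a)) + pi
     else if 0 < a then mod2pi (atan (- (b / a)))
     else pi / 2 * Num.sg b + pi) in
  global_minimizer `[0, 1]
    (subproblem psi L U Bbar gradp gradm i l tau gamma) alpha.

Proof.
move=> Bi BL BU CU CL c0 c1 c2 a b alpha.
have psiE d : 0 <= d <= 1 ->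
    mxpart RePart (psi l d) = rotconj (pi * d) Br
    /\ mxpart ImPart (psi l d) = 0.
  by move=> /hrot ->; exact: mxpart_real.
have d0 : 0 <= (0 : R) <= 1 by rewrite lexx ler01.
have [l0 L0] := hLU.1; have [u0 U0] := hLU.2.1.
(* The path starts at Br itself, so the asymptotes strictly enclose Br. *)
have [unitL unitU] :
    mxpart RePart L - Br \in unitmx /\ mxpart RePart U - Br \in unitmx.
  have gY : graph_set psi (psi l 0).
    by exists l => //; exists 0 => //=; rewrite in_itv.
  have [LY YU] := hLU.2.2 _ gY RePart.
  have [Y0 _] := psiE 0 d0; move: LY YU; rewrite /loewner_lt Y0 mulr0 rotconj0.
  move=> /posdef_unitmx uL /posdef_unitmx uU; split=> //.
  by rewrite -opprB -scaleN1r unitmxZ // unitrN1.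
rewrite L0 U0 !mxpart_scalar in unitL unitU.
have [kU hU] := term_rotconj _ tau CU Bi Br hBr unitU.
have [kL hL] := term_rotconj _ (- tau) CL Bi Br hBr unitL.
pose kI := approx_term L U Bbar gradp gradm i tau ImPart 0.
have objE y : 0 <= y <= 1 ->
    subproblem psi L U Bbar gradp gradm i l tau gamma y
    = kU + kL + kI + 2^-1 * (b * sin (2 * pi * y) - a * cos (2 * pi * y)).
  move=> y01; rewrite /subproblem; have [-> ->] := psiE y y01.
  rewrite hgamma !mul0r addr0 -/kI /approx_term -/Bi -/CU -/CL -scaleNr.
  rewrite {1}U0 {1}L0 !mxpart_scalar hU hL.
  have -> : pi * y *+ 2 = 2 * pi * y by ring.
  rewrite /a /b /c0 /c1 /c2 /BL /BU L0 U0 !mxpart_scalar.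
  by field.
have p0 : 0 < 2 * pi :> R by rewrite mulr_gt0 ?pi_gt0.
have alphaE : 2 * pi * alpha = optimal_angle a b.
  by rewrite mulVKf ?gt_eqF.
have a01 : 0 <= alpha <= 1.
  have := optimal_angle_itv a b; rewrite -alphaE => /andP[].
  by rewrite pmulr_rge0 // ger_pMr // => -> ->.
split => [|y]; first by rewrite /= in_itv.
rewrite /= in_itv /= => y01.
rewrite (objE _ a01) (objE _ y01) lerD2l ler_pM2l ?invr_gt0 // alphaE.
have [r [r0 ra rb]] := optimal_angle_polar a b.
exact: sinusoid_min r0 ra rb _.
Qed.
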